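(* Let $M$ be an $L$-structure and $\phi(x,y)$ an $L$-formula. Let $N\succeq M$ and let $q\in S_{\phi(x)}(N)$ be finitely satisfiable in $M$. Let $\epsilon>0$ and $\delta\geq0$. Suppose $\phi(x,y)$ is $\epsilon$-stable in $M$ and $\psi(y)$ is an $L$-formula with parameters from $M$ such that $\mathfrak d(\phi(q,b),\psi^M(b))\leq\delta$ for all $b\in M^y$. Then $\mathfrak d(\phi(q,b),\psi^N(b))\leq\delta+\epsilon$ for all $b\in N^y$.
   Context: Logic: We work in continuous (metric) first-order logic with values in $\mathfrak V=\ell^\infty(\omega)$ (real Banach space), with metric $\mathfrak d(\mathfrak r,\mathfrak s)=\|\mathfrak r-\mathfrak s\|_\infty$; an isometric copy $\mathbb R\hookrightarrow\mathfrak V$ is fixed. It is set up as standard $[0,1]$-valued continuous logic (complete metric structures, possibly many-sorted, symbols with prescribed moduli of uniform continuity), except that each predicate symbol $P$ of the language $L$ comes with a compact set $K_P\subseteq\mathfrak V$ in which it takes values; connectives are all continuous functions $u:\mathfrak V^n\to\mathfrak V$; and $\sup_x\psi$, $\inf_x\psi$ are formed only for formulas $\psi$ with value set $K_\psi\subseteq\mathbb R^{\geq0}$. Inductively each formula $\phi$ has a compact value set $K_\phi\subseteq\mathfrak V$ ($K_{u(\phi_0,\ldots,\phi_{n-1})}=u(\prod_i K_{\phi_i})$, and $K_{\sup_x\psi}=K_{\inf_x\psi}=K_\psi$), and $\phi^M$ takes values in $K_\phi$ in every $L$-structure $M$. Here $x,y$ are tuples of variables and $M^x$ is the product of sorts of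 $M$ corresponding to $x$. $N\succeq M$ means $N$ is an elementary extension of $M$. Types: $S_{\phi(x)}(N)$ is the set of complete $\phi(x)$-types over $N$. A type $q\in S_{\phi(x)}(N)$ is determined by the function $b\mapsto\phi(q,b)$ from $N^y$ to $K_\phi$, where $\phi(q,b)=\phi^{N'}(a,b)$ for any realization $a\in N'^x$ of $q$ in some $N'\succeq N$. Finite satisfiability: for $N\succeq M$, a type $q\in S_{\phi(x)}(N)$ is finitely satisfiable in $M$ if, for every $n<\omega$, $b_0,\ldots,b_{n-1}\in N^y$ and $\delta>0$, there is some $a\in M^x$ such that $\mathfrak d(\phi^N(a,b_i),\phi(q,b_i))<\delta$ for all $i<n$. Stability: $\phi(x,y)$ is $\epsilon$-stable in $M$ if there are no sequences $\langle a_i\rangle_{i<\omega}$ in $M^x$ and $\langle b_i\rangle_{i<\omega}$ in $M^y$ such that $\mathfrak d(\phi^M(a_i,b_j),\phi^M(a_j,b_i))\geq\epsilon$ for all $i<j<\omega$. *)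

(* Defs.v *)
From HB Require Import structures.
From mathcomp Require Import all_boot all_order all_algebra.
From mathcomp Require Import all_classical all_reals all_analysis.
Import Order.TTheory GRing.Theory Num.Theory.
Import numFieldNormedType.Exports.

Set Implicit Arguments.
Unset Strict Implicit.
Unset Printing Implicit Defensive.

Local Open Scope classical_set_scope.
Local Open Scope ring_scope.

Section LInfty.
Variable R : realType.

Definition bounded_seq : {pred nat -> R} :=
  fun f => `[< exists C : R, forall n, `|f n| <= C >].

Record linfty := Linfty {
  linfty_val :> nat -> R;
  linfty_bounded : linfty_val \in bounded_seq }.

HB.instance Definition _ := [isSub for linfty_val].
HB.instance Definition _ := [Choice of linfty by <:].

Lemma bounded_seqP (f : nat -> R) :
  f \in bounded_seq <-> exists C : R, forall n, `|f n| <= C.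
Proof. by rewrite unfold_in; split => [/asboolP//|?]; apply/asboolP. Qed.

Lemma bounded_seq_submod : submod_closed bounded_seq.
Proof.
split; first by apply/bounded_seqP; exists 0 => n; rewrite normr0.
move=> k f g /bounded_seqP[C fC] /bounded_seqP[D gD].
apply/bounded_seqP; exists (`|k| * C + D) => n.
apply: (le_trans (ler_normD _ _)); apply: lerD => //.
by rewrite normrZ ler_wpM2l.
Qed.

HB.instance Definition _ :=
  GRing.isSubmodClosed.Build R (nat -> R) bounded_seq bounded_seq_submod.
HB.instance Definition _ := [SubChoice_isSubLmodule of linfty by <:].

Definition linfty_norm (x : linfty) : R := sup [set `|x n| | n in [set: nat]].

Lemma linfty_norm_ub (x : linfty) n : `|x n| <= linfty_norm x.
Proof.
have /bounded_seqP[C xC] := linfty_bounded x.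
apply: ub_le_sup; last by exists n.
by exists C => _ [m _ <-].
Qed.

Lemma linfty_norm_le (x : linfty) C :
  (forall n, `|x n| <= C) -> linfty_norm x <= C.
Proof.
move=> xC; apply: ge_sup; first by exists `|x 0%N|, 0%N.
by move=> _ [n _ <-].
Qed.

Lemma linfty_normD x y : linfty_norm (x + y) <= linfty_norm x + linfty_norm y.
Proof.
apply: linfty_norm_le => n.
by apply: (le_trans (ler_normD _ _)); apply: lerD; exact: linfty_norm_ub.
Qed.

Lemma linfty_normZ k x : linfty_norm (k *: x) = `|k| * linfty_norm x.
Proof.
have le_normZ l y : linfty_norm (l *: y) <= `|l| * linfty_norm y.
  apply: linfty_norm_le => n; rewrite [X in `|X|]/(l * y n) normrM.
  by rewrite ler_wpM2l// linfty_norm_ub.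
apply/eqP; rewrite eq_le le_normZ /=.
have [->|k0] := eqVneq k 0.
  rewrite normr0 mul0r.
  exact: le_trans (normr_ge0 _) (linfty_norm_ub _ 0%N).
rewrite -ler_pdivlMl ?normr_gt0// -normfV.
by have := le_normZ k^-1 (k *: x); rewrite scalerA mulVf// scale1r.
Qed.

Lemma linfty_norm0_eq0 x : linfty_norm x = 0 -> x = 0.
Proof.
move=> x0; apply/val_inj/funext => n; apply/normr0_eq0/eqP.
by rewrite eq_le normr_ge0 andbT -x0 linfty_norm_ub.
Qed.

HB.instance Definition _ :=
  Lmodule_isNormed.Build R linfty linfty_normD linfty_normZ linfty_norm0_eq0.

(* Only isometry is required of the fixed copy of the reals, not linearity. *)
Record real_copy := RealCopy {
  real_copy_val :> R -> linfty;
  real_copy_isometry : forall r s,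
    `|real_copy_val r - real_copy_val s| = `|r - s| }.

End LInfty.

(* Finite tuples of variables, indexed by an arbitrary finite type, each
   variable carrying its sort. *)
Record ctx (S : Type) := Ctx { ctx_index :> finType; ctx_sort : ctx_index -> S }.
Arguments Ctx {S}.
Arguments ctx_sort {S} _ _.

Definition ctx_cat (S : Type) (x y : ctx S) : ctx S :=
  Ctx (x + y)%type
    (fun v => match v with inl i => ctx_sort x i | inr j => ctx_sort y j end).

Definition ctx_cons (S : Type) (s : S) (x : ctx S) : ctx S :=
  Ctx (option x) (fun v => if v is Some i then ctx_sort x i else s).

(* [lang_diam s] bounds the metric of sort [s]; the value set of the metric is
   [0, lang_diam s], and [lang_diam s = 1] is the [0,1]-valued convention. *)
Record language (R : realType) := Language {
  lang_sort : Type;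
  lang_diam : lang_sort -> R;
  lang_pred : Type;
  pred_arity : lang_pred -> ctx lang_sort;
  pred_range : lang_pred -> set (linfty R);
  pred_range_compact : forall P, compact (pred_range P);
  pred_mod : lang_pred -> R -> R;
  pred_mod_gt0 : forall P e, 0 < e -> 0 < pred_mod P e;
  lang_fun : Type;
  fun_arity : lang_fun -> ctx lang_sort;
  fun_sort : lang_fun -> lang_sort;
  fun_mod : lang_fun -> R -> R;
  fun_mod_gt0 : forall f e, 0 < e -> 0 < fun_mod f e }.

Definition vtuple (S : Type) (A : S -> Type) (x : ctx S) : Type :=
  forall i : x, A (ctx_sort x i).

Record structure (R : realType) (L : language R) := Structure {
  carrier :> lang_sort L -> metricType R;
  carrier_nonempty : forall s, inhabited (carrier s);
  carrier_complete : forall s (F : set_system (carrier s)),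
    ProperFilter F -> cauchy F -> exists m : carrier s, F --> m;
  carrier_diam : forall s (a b : carrier s), mdist a b <= lang_diam s;
  pred_interp : forall P, vtuple carrier (pred_arity P) -> linfty R;
  pred_interp_range : forall P a, pred_range P (@pred_interp P a);
  pred_interp_mod : forall P e a b, 0 < e ->
    (forall i, mdist (a i) (b i) < pred_mod P e) ->
    `|@pred_interp P a - @pred_interp P b| <= e;
  fun_interp : forall f, vtuple carrier (fun_arity f) -> carrier (fun_sort f);
  fun_interp_mod : forall f e a b, 0 < e ->
    (forall i, mdist (a i) (b i) < fun_mod f e) ->
    mdist (@fun_interp f a) (@fun_interp f b) <= e }.
Arguments pred_interp {R L} _ _ _.
Arguments fun_interp {R L} _ _ _.

Notation tuples M x := (vtuple (carrier M) x).

Section Tuples.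
Variables (R : realType) (L : language R).
Implicit Types (M N : structure L) (x y : ctx (lang_sort L)).

Definition tuples_cat M x y (a : tuples M x) (b : tuples M y) :
    tuples M (ctx_cat x y) :=
  fun v => match v return M (ctx_sort (ctx_cat x y) v) with
           | inl i => a i | inr j => b j end.

Definition tuples_cons M s x (m : M s) (a : tuples M x) :
    tuples M (ctx_cons s x) :=
  fun v => match v return M (ctx_sort (ctx_cons s x) v) with
           | Some i => a i | None => m end.

Definition tuples_map M N (h : forall s, M s -> N s) x (a : tuples M x) :
    tuples N x :=
  fun i => h _ (a i).

End Tuples.

Section Syntax.
Variables (R : realType) (iota : real_copy R) (L : language R).

Inductive term (x : ctx (lang_sort L)) : lang_sort L -> Type :=
| Var (i : x) : term x (ctx_sort x i)
| App (f : lang_fun L) :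
    (forall i : fun_arity f, term x (ctx_sort (fun_arity f) i)) ->
    term x (fun_sort f).

(* [formula x K] is the type of formulas in the free variables [x] whose
   inductively computed compact value set is [K]; indexing by [K] lets the
   quantifiers be restricted to formulas with nonnegative real values. *)
Inductive formula : ctx (lang_sort L) -> set (linfty R) -> Type :=
| Pred x (P : lang_pred L) :
    (forall i : pred_arity P, term x (ctx_sort (pred_arity P) i)) ->
    formula x (pred_range P)
| Dist x s (t u : term x s) :
    formula x (iota @` [set r | 0 <= r <= lang_diam s])
| Conn x (n : nat) (u : {ptws 'I_n -> linfty R} -> linfty R)
    (K : 'I_n -> set (linfty R)) :
    continuous u -> (forall i, formula x (K i)) ->
    formula x (u @` [set v | forall i, K i (v i)])
| Sup x s (K : set (linfty R)) :
    K `<=` iota @` [set r | 0 <= r] -> formula (ctx_cons s x) K -> formula x K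
| Inf x s (K : set (linfty R)) :
    K `<=` iota @` [set r | 0 <= r] -> formula (ctx_cons s x) K -> formula x K.

Fixpoint teval (M : structure L) x (a : tuples M x) s (t : term x s) :
    M s :=
  match t in term _ s return M s with
  | Var i => a i
  | App f ts => fun_interp M f (fun i => teval a (ts i))
  end.

Fixpoint feval (M : structure L) x K (phi : formula x K) :
    tuples M x -> linfty R :=
  match phi in formula x K return tuples M x -> linfty R with
  | Pred x P ts => fun a => pred_interp M P (fun i => teval a (ts i))
  | Dist x s t u => fun a => iota (mdist (teval a t) (teval a u))
  | Conn x n u K _ phis => fun a => u (fun i => feval (phis i) a)
  | Sup x s K _ psi => fun a =>
      iota (sup [set r | exists m : M s, feval psi (tuples_cons m a) = iota r])
  | Inf x s K _ psi => fun a =>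
      iota (inf [set r | exists m : M s, feval psi (tuples_cons m a) = iota r])
  end.

(* An elementary extension [N] of [M], with the inclusion as an explicit map. *)
Record elem_ext (M N : structure L) := ElemExt {
  ext_map :> forall s, M s -> N s;
  ext_dist : forall s (a b : M s), mdist (ext_map a) (ext_map b) = mdist a b;
  ext_pred : forall P a,
    pred_interp N P (tuples_map ext_map a) = pred_interp M P a;
  ext_fun : forall f a,
    fun_interp N f (tuples_map ext_map a) = ext_map (fun_interp M f a);
  ext_eval : forall x K (phi : formula x K) (a : tuples M x),
    feval phi (tuples_map ext_map a) = feval phi a }.

(* Formulas psi(y, c) with parameters: an L-formula psi(y, z) and c in M^z. *)
Record pformula (M : structure L) (y : ctx (lang_sort L)) := PFormula {
  pf_ctx : ctx (lang_sort L);
  pf_range : set (linfty R);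
  pf_formula : formula (ctx_cat y pf_ctx) pf_range;
  pf_param : tuples M pf_ctx }.
Arguments pf_param {M y} _ _.

Definition peval (M : structure L) y (psi : pformula M y) (b : tuples M y) :=
  feval (pf_formula psi) (tuples_cat b (pf_param psi)).

Definition peval_ext (M N : structure L) (h : elem_ext M N) y
    (psi : pformula M y) (b : tuples N y) :=
  feval (pf_formula psi) (tuples_cat b (tuples_map h (pf_param psi))).

Section Types.
Variables (x y : ctx (lang_sort L)) (K : set (linfty R)).
Variable phi : formula (ctx_cat x y) K.

(* A complete phi-type over [N], as the function b |-> phi(q, b) it is
   determined by: the one given by some realization in an elementary extension
   of [N]. *)
Record phi_type (N : structure L) := PhiType {
  type_val :> tuples N y -> linfty R;
  type_realized : exists (N' : structure L) (h : elem_ext N N')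
      (a : tuples N' x),
    forall b, type_val b = feval phi (tuples_cat a (tuples_map h b)) }.

Definition finitely_satisfiable (M N : structure L) (h : elem_ext M N)
    (q : phi_type N) : Prop :=
  forall (n : nat) (b : 'I_n -> tuples N y) (delta : R), 0 < delta ->
  exists a : tuples M x, forall i : 'I_n,
    `|feval phi (tuples_cat (tuples_map h a) (b i)) - q (b i)| < delta.

Definition stable_in (eps : R) (M : structure L) : Prop :=
  ~ exists (a : nat -> tuples M x) (b : nat -> tuples M y),
      forall i j : nat, (i < j)%N ->
        eps <= `|feval phi (tuples_cat (a i) (b j)) -
                 feval phi (tuples_cat (a j) (b i))|.

End Types.
End Syntax.

(* Main.v *)
(* Suppose d(q(b), psi(b)) > delta + eps for some b in N^y.  Choose
   alternately a_n in M^x approximating q on b, b_0, ..., b_(n-1), by finite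
   satisfiability, and b_n in M^y approximating b on psi and on
   phi(a_0, y), ..., phi(a_n, y), by elementarity.  For i < j, phi(a_i, b_j) is
   then close to q(b), while phi(a_j, b_i) is close to q(b_i), which is within
   delta of psi(b_i), itself close to psi(b); this contradicts eps-stability. *)
Require Import Defs.
From mathcomp Require Import all_boot all_order all_algebra.
From mathcomp Require Import all_classical all_reals all_analysis.
From mathcomp Require Import lra.
Import Order.TTheory GRing.Theory Num.Theory.
Import numFieldNormedType.Exports.
Local Open Scope ring_scope.

Set Implicit Arguments.
Unset Strict Implicit.
Unset Printing Implicit Defensive.

(** * The copy of the reals, and sums of distances as a connective *)

Section RealCopy.
Variables (R : realType) (iota : real_copy R).

Lemma real_copy_inj : injective iota.
Proof.
move=> r s irs; apply/eqP; rewrite -subr_eq0 -normr_eq0.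
by rewrite -(real_copy_isometry iota) irs subrr normr0.
Qed.

Lemma real_copy_continuous : continuous iota.
Proof.
move=> r; apply/cvgrPdist_lt => e e0; near=> s.
rewrite real_copy_isometry; near: s.
exact: (@cvgr_dist_lt _ _ _ (nbhs r) _ id r cvg_id).
Unshelve. all: by end_near. Qed.

Lemma continuous_sum (T : topologicalType) n (f : 'I_n -> T -> R) :
  (forall i, continuous (f i)) -> continuous (fun x => \sum_(i < n) f i x).
Proof.
move=> fc x; apply: cvg_big => [|i _]; last exact: fc.
exact: add_continuous.
Qed.

Lemma continuous_dist (V : normedModType R) (c : V) :
  continuous (fun v : V => `|v - c|).
Proof.
move=> v; apply: (@cvg_norm _ _ _ (nbhs v)).
by apply: cvgB; [exact: cvg_id|exact: cvg_cst].
Qed.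

(** Folds finitely many closeness conditions into one connective; the outer [iota] makes its values
    nonnegative reals, so that [Inf] may be formed. *)
Definition sum_dist n (c : 'I_n -> linfty R) (v : {ptws 'I_n -> linfty R}) :
    linfty R :=
  iota (\sum_(i < n) `|v i - c i|).

Lemma sum_dist_continuous n (c : 'I_n -> linfty R) : continuous (sum_dist c).
Proof.
move=> v; apply: (@continuous_comp _ _ _
  (fun w : {ptws 'I_n -> linfty R} => \sum_(i < n) `|w i - c i|) iota);
  last exact: real_copy_continuous.
apply: continuous_sum => i {}v.
apply: (@continuous_comp {ptws 'I_n -> linfty R} (linfty R) R (fun w => w i)
  (fun z => `|z - c i|)); last exact: continuous_dist.
exact: (@proj_continuous _ (fun _ : 'I_n => linfty R) i v).
Qed.

Lemma sum_dist_nonneg n (c : 'I_n -> linfty R) (A : set ('I_n -> linfty R)) :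
  (sum_dist c @` A `<=` iota @` [set r | 0 <= r])%classic.
Proof. by move=> _ [v _ <-]; eexists; last by []; exact: sumr_ge0. Qed.

End RealCopy.

(** * Substitution of terms into formulas *)

Section Substitution.
Variables (R : realType) (iota : real_copy R) (L : language R).
Implicit Types (M : structure L) (x y : ctx (lang_sort L)).

Definition subst x y := forall i : x, term y (ctx_sort x i).

Fixpoint tsubst x y (f : subst x y) s (t : term x s) : term y s :=
  match t in term _ s return term y s with
  | Var i => f i
  | App g ts => App (fun i => tsubst f (ts i))
  end.

Lemma teval_tsubst M x y (f : subst x y) (a : tuples M y) s (t : term x s) :
  teval a (tsubst f t) = teval (fun i => teval a (f i)) t.
Proof.
elim: t => //= g ts IH; congr (fun_interp M g _).
by apply: functional_extensionality_dep => i.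
Qed.

Definition subst_cons s x y (f : subst x y) :
    subst (ctx_cons s x) (ctx_cons s y) :=
  fun v => match v return term (ctx_cons s y) (ctx_sort (ctx_cons s x) v) with
           | Some i => tsubst (fun j => Var (Some j : ctx_cons s y)) (f i)
           | None => Var (None : ctx_cons s y) end.

Lemma teval_subst_cons M s x y (f : subst x y) (m : M s) (a : tuples M y) :
  (fun i => teval (tuples_cons m a) (subst_cons f i)) =
  tuples_cons m (fun i => teval a (f i)).
Proof.
by apply: functional_extensionality_dep => -[i|] //=; rewrite teval_tsubst.
Qed.

(** The index [K] is kept, so the side conditions of [Sup] and [Inf] carry over unchanged. *)
Fixpoint fsubst x K (phi : formula iota x K) :
    forall y, subst x y -> formula iota y K :=
  match phi in formula _ x K return forall y, subst x y -> formula iota y K with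
  | Pred x P ts => fun y f => Pred iota (fun i => tsubst f (ts i))
  | Dist x s t u => fun y f => Dist iota (tsubst f t) (tsubst f u)
  | Conn x n u K uc phis => fun y f => Conn uc (fun i => fsubst (phis i) f)
  | Sup x s K Kpos psi => fun y f => Sup Kpos (fsubst psi (subst_cons f))
  | Inf x s K Kpos psi => fun y f => Inf Kpos (fsubst psi (subst_cons f))
  end.

Lemma feval_fsubst M x K (phi : formula iota x K) y (f : subst x y)
    (a : tuples M y) :
  feval (fsubst phi f) a = feval phi (fun i => teval a (f i)).
Proof.
elim: phi y f a => {x K}
  [x P ts|x s t u|x n u K uc phis IH|x s K Kpos psi IH|x s K Kpos psi IH]
  y f a /=.
- congr (pred_interp M P _); apply: functional_extensionality_dep => i.
  exact: teval_tsubst.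
- by rewrite !teval_tsubst.
- by congr u; apply/funext => i.
- congr (iota (sup _)); apply/seteqP; split=> r [m mr]; exists m; move: mr;
  by rewrite IH teval_subst_cons.
- congr (iota (inf _)); apply/seteqP; split=> r [m mr]; exists m; move: mr;
  by rewrite IH teval_subst_cons.
Qed.

(** Parameters of a [pformula] sit in the second half of the context; the swap lets phi(a, y) be
    one, with parameters a. *)
Definition swap_formula x y K (phi : formula iota (ctx_cat x y) K) :
    formula iota (ctx_cat y x) K :=
  fsubst phi (fun v =>
    match v return term (ctx_cat y x) (ctx_sort (ctx_cat x y) v) with
    | inl i => Var (inr i : ctx_cat y x)
    | inr j => Var (inl j : ctx_cat y x) end).

Lemma feval_swap_formula M x y K (phi : formula iota (ctx_cat x y) K)
    (a : tuples M x) (b : tuples M y) :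
  feval (swap_formula phi) (tuples_cat b a) = feval phi (tuples_cat a b).
Proof.
rewrite feval_fsubst; congr (feval phi _).
by apply: functional_extensionality_dep => -[].
Qed.

End Substitution.

(** * Infima over single variables, and reflection of strict bounds into [M] *)

Section Infimum.
Variables (R : realType) (iota : real_copy R) (L : language R).
Implicit Types (M N : structure L) (x y w : ctx (lang_sort L)).

(** A semantic condition, as [K] is computed from the syntax alone; it bounds the sets under [inf]
    below by 0. *)
Definition nonneg_valued w K (chi : formula iota w K) : Prop :=
  forall M (a : tuples M w), exists2 r, 0 <= r & feval chi a = iota r.

Variables (w : ctx (lang_sort L)) (K : set (linfty R)).
Hypothesis Kpos : (K `<=` iota @` [set r | 0 <= r])%classic.

Definition inf_subst (i : w) : subst w (ctx_cons (ctx_sort w i) w) :=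
  dfwith (fun j => Var (Some j : ctx_cons (ctx_sort w i) w))
    i (Var (None : ctx_cons (ctx_sort w i) w)).

(* The infimum over the variable [i], which stays in the context as a dummy. *)
Definition inf_at (chi : formula iota w K) (i : w) : formula iota w K :=
  Inf Kpos (fsubst chi (@inf_subst i)).

Lemma feval_inf_at M (chi : formula iota w K) (i : w) (a : tuples M w) :
  feval (inf_at chi i) a =
  iota (inf [set r | exists m, feval chi (dfwith a i m : tuples M w) = iota r]).
Proof.
rewrite /=; congr (iota (inf _)).
suff E (m : M (ctx_sort w i)) : (fun j => teval (tuples_cons m a) (inf_subst i j))
    = dfwith a i m :> tuples M w.
  by apply/seteqP; split=> r [m mr]; exists m; move: mr; rewrite feval_fsubst E.
apply: functional_extensionality_dep => j; rewrite /inf_subst.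
by case: dfwithP => [|k ik]; [rewrite dfwithin|rewrite dfwithout].
Qed.

Lemma nonneg_valued_inf_at (chi : formula iota w K) (i : w) :
  nonneg_valued chi -> nonneg_valued (inf_at chi i).
Proof.
move=> chi0 M a; rewrite feval_inf_at; eexists; last by [].
have [r _ rE] := chi0 M (dfwith a i (a i)).
apply: lb_le_inf => [|s [m]]; first by exists r, (a i).
by have [t t0 ->] := chi0 M (dfwith a i m) => /real_copy_inj <-.
Qed.

(** An infimum may fail to be attained, but a strict upper bound on it always has a witness. *)
Lemma inf_at_lt M (chi : formula iota w K) (i : w) (a : tuples M w) r e :
  nonneg_valued chi -> feval (inf_at chi i) a = iota r ->
  (r < e <-> exists m s, feval chi (dfwith a i m) = iota s /\ s < e).
Proof.
move=> chi0; rewrite feval_inf_at => /real_copy_inj <-; split.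
  move=> /inf_lt[|s [m ms] se]; last by exists m, s.
  by have [s _ sE] := chi0 M (dfwith a i (a i)); exists s, (a i).
move=> [m [s [ms se]]]; apply: le_lt_trans se; apply: ge_inf; last by exists m.
exists 0 => t [m']; have [u u0 ->] := chi0 M (dfwith a i m').
by move=> /real_copy_inj <-.
Qed.

(* Induction on the list [l] of variables still to be moved into [M]: each
   step replaces [chi] by its infimum over one of them. *)
Lemma elem_ext_reflect_lt M N (h : elem_ext iota M N) (l : seq w)
    (chi : formula iota w K) (a : tuples M w) (b : tuples N w) r e :
  nonneg_valued chi -> (forall i, i \notin l -> b i = h _ (a i)) ->
  feval chi b = iota r -> r < e ->
  exists (a' : tuples M w) s, [/\ forall i, i \notin l -> a' i = a i,
    feval chi a' = iota s & s < e].
Proof.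
elim: l chi a b r => [|i l IH] chi a b r chi0 ab br re.
  (* With no variable left to move, [b] is the image of [a] and elementarity applies. *)
  exists a, r; split=> //; rewrite -br -(ext_eval h); congr feval.
  by apply: functional_extensionality_dep => i; rewrite ab.
(* The infimum over [i] ignores coordinate [i], which may thus be reset to the image of [a i]; the
   old [b i] witnesses that the infimum is below [e]. *)
pose b' : tuples N w := dfwith b i (h _ (a i)).
have [t _ b't] := nonneg_valued_inf_at i chi0 b'.
have te : t < e.
  apply/(inf_at_lt _ chi0 b't); exists (b i), r; split=> //.
  rewrite -br; congr feval; apply: functional_extensionality_dep => j.
  case: dfwithP => // k ik; rewrite /b' dfwithout//.
have [|a' [s [a'a a's se]]] :=
  IH _ a b' t (nonneg_valued_inf_at i chi0) _ b't te.
  move=> j jl; rewrite /b'; case: dfwithP jl => // k ik kl.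
  by apply: ab; rewrite inE negb_or eq_sym ik.
(* The bound on the infimum now holds in [M], so a witness for coordinate [i] exists there. *)
have [m [u [mu ue]]] := (inf_at_lt e chi0 a's).1 se.
exists (dfwith a' i m), u; split=> // j; rewrite inE negb_or => /andP[ji jl].
by rewrite dfwithout 1?eq_sym// a'a.
Qed.

End Infimum.

(** * Approximation of tuples of [N] by tuples of [M] *)

Section Approximation.
Variables (R : realType) (iota : real_copy R) (L : language R).
Variables (M N : structure L) (h : elem_ext iota M N).

Lemma tuples_map_cat (x y : ctx (lang_sort L))
    (a : tuples M x) (b : tuples M y) :
  tuples_map h (tuples_cat a b) = tuples_cat (tuples_map h a) (tuples_map h b).
Proof. by apply: functional_extensionality_dep => -[]. Qed.

Lemma feval_tuples_cat_map (x y : ctx (lang_sort L)) K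
    (phi : formula iota (ctx_cat x y) K) (a : tuples M x) (b : tuples M y) :
  feval phi (tuples_cat (tuples_map h a) (tuples_map h b)) =
  feval phi (tuples_cat a b).
Proof. by rewrite -tuples_map_cat ext_eval. Qed.

Lemma tuples_inhabited (y : ctx (lang_sort L)) : inhabited (tuples M y).
Proof.
constructor=> i; apply: (projT1 (cid _ : {m : M (ctx_sort y i) | True})).
by have [m] := carrier_nonempty M (ctx_sort y i); exists m.
Qed.

(** The sum of the distances of the [p i] to their values at [b] is a single formula vanishing at
    [b]. Reflecting the bound [e] into [M] bounds every summand. *)
Lemma elem_ext_approx_ord (y : ctx (lang_sort L)) n
    (p : 'I_n -> pformula iota M y) (b : tuples N y) e : 0 < e ->
  exists a : tuples M y, forall i, `|peval (p i) a - peval_ext h (p i) b| < e.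
Proof.
(* [a0] is an arbitrary filler: all its coordinates may be replaced by the reflection. *)
move=> e0; have [a0] := tuples_inhabited y.
(* The parameter contexts of all [p i] are pooled, so that one context serves the whole sum. *)
pose z : ctx (lang_sort L) := Ctx {i : 'I_n & pf_ctx (p i)}
  (fun t => ctx_sort (pf_ctx (p (tag t))) (tagged t)).
pose f i : subst (ctx_cat y (pf_ctx (p i))) (ctx_cat y z) := fun v =>
  match v return term (ctx_cat y z) (ctx_sort (ctx_cat y (pf_ctx (p i))) v) with
  | inl j => Var (inl j : ctx_cat y z)
  | inr k => Var (inr (Tagged (fun i => pf_ctx (p i)) k) : ctx_cat y z) end.
pose c : tuples M z := fun t =>
  pf_param (tagged t : pf_ctx (p (tag t))).
have feval_f i M' (b' : tuples M' y) (c' : tuples M' z) :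
    feval (fsubst (pf_formula (p i)) (f i)) (tuples_cat b' c') =
    feval (pf_formula (p i)) (tuples_cat b'
      (fun k => c' (Tagged (fun i => pf_ctx (p i)) k))).
  rewrite feval_fsubst; congr feval.
  by apply: functional_extensionality_dep => -[].
pose d i := peval_ext h (p i) b.
pose chi := Conn (@sum_dist_continuous _ iota _ d)
  (fun i => fsubst (pf_formula (p i)) (f i)).
have chi0 : nonneg_valued chi.
  by move=> M' a; eexists; last by []; exact: sumr_ge0.
have chib : feval chi (tuples_cat b (tuples_map h c)) = iota 0.
  by rewrite /= /sum_dist big1// => i _; rewrite feval_f subrr normr0.
(* Only the variables of [y] are moved; those of [z] stay frozen at the parameters [c]. *)
have [|a [s [ac]]] := elem_ext_reflect_lt (@sum_dist_nonneg _ _ _ _ _) (h := h)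
  (l := [seq (inl j : ctx_cat y z) | j <- enum y]) (a := tuples_cat a0 c) chi0 _ chib e0.
  move=> [j|//]; rewrite mem_map ?mem_enum//; exact: inl_inj.
move=> /real_copy_inj <- ae; exists (fun j => a (inl j)) => i.
apply: le_lt_trans ae; rewrite (bigD1 i)//=.
suff <- : feval (fsubst (pf_formula (p i)) (f i)) a =
    peval (p i) (fun j => a (inl j)) by rewrite lerDl sumr_ge0.
rewrite feval_fsubst; congr feval.
apply: functional_extensionality_dep => -[//|k] /=.
by rewrite ac//; apply/mapP => -[].
Qed.

Lemma elem_ext_approx (y : ctx (lang_sort L)) (I : finType)
    (p : I -> pformula iota M y) (b : tuples N y) e : 0 < e ->
  exists a : tuples M y, forall i, `|peval (p i) a - peval_ext h (p i) b| < e.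
Proof.
move=> e0.
have [a pa] := elem_ext_approx_ord (fun k : 'I_#|I| => p (enum_val k)) b e0.
by exists a => i; rewrite -(enum_rankK i).
Qed.

Lemma finitely_satisfiable_fin (x y : ctx (lang_sort L)) K
    (phi : formula iota (ctx_cat x y) K) (q : phi_type phi N) (I : finType)
    (b : I -> tuples N y) e :
  finitely_satisfiable h q -> 0 < e ->
  exists a : tuples M x, forall i,
    `|feval phi (tuples_cat (tuples_map h a) (b i)) - q (b i)| < e.
Proof.
move=> hq e0; have [a qa] := hq _ (fun k : 'I_#|I| => b (enum_val k)) e e0.
by exists a => i; rewrite -(enum_rankK i).
Qed.

End Approximation.

(** * Recursive choice of the two sequences, and the final estimate *)

(** [F] selects a term suited to a whole list of earlier ones; iterating [rcons] makes [l n] the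
    list of the first [n] terms. *)
Lemma dependent_choice_prefix (T : Type) (P : T -> T -> Prop) (Q : T -> Prop) :
  (forall n (s : 'I_n -> T), exists t, Q t /\ forall i, P (s i) t) ->
  exists t : nat -> T,
    (forall i, Q (t i)) /\ forall i j, (i < j)%N -> P (t i) (t j).
Proof.
move=> PQ.
(* The empty prefix already yields an element of [T], used as default for [nth]. *)
have [t0 _] := PQ 0%N (fun i : 'I_0 => let: Ordinal _ i0 := i in
  False_rect T (Bool.diff_false_true i0)).
have /choice[F FP] (l : seq T) : exists t, Q t /\
    forall i : 'I_(size l), P (nth t0 l i) t.
  exact: (PQ _ (fun i : 'I_(size l) => nth t0 l i)).
pose l n := iter n (fun l => rcons l (F l)) [::].
have lsize n : size (l n) = n by elim: n => //= n; rewrite size_rcons => ->.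
have lnth i j : (i < j)%N -> nth t0 (l j) i = F (l i).
  elim: j => // j IH; rewrite ltnS leq_eqVlt /= nth_rcons lsize.
  by case: ltngtP => //= [ij _|-> _ //]; exact: IH.
exists (fun n => F (l n)); split=> [i|i j ij]; first exact: (FP _).1.
rewrite -(lnth i j)//; have ijs : (i < size (l j))%N by rewrite lsize.
exact: ((FP (l j)).2 (Ordinal ijs)).
Qed.

(** Triangle inequality along the chain [q0], [w], [u], [v], [q1], [p1], [p0]: four links are below
    [eta] and one is at most [delta], leaving [eps] for the link from [u] to [v]. *)
Lemma dist_chain_ge (R : realType) (V : normedModType R)
    (q0 w u v q1 p1 p0 : V) (eta delta eps : R) :
  eta * 4 = `|q0 - p0| - (delta + eps) ->
  `|w - q0| < eta -> `|u - w| < eta -> `|v - q1| < eta ->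
  `|q1 - p1| <= delta -> `|p1 - p0| < eta -> eps <= `|u - v|.
Proof.
rewrite (distrC w) (distrC u w).
move: (ler_distD w q0 p0) (ler_distD u w p0) (ler_distD v u p0).
move: (ler_distD q1 v p0) (ler_distD p1 q1 p0).
lra.
Qed.

Theorem lemma3p9 (R : realType) (iota : real_copy R) (L : language R)
    (M N : structure L) (h : elem_ext iota M N)
    (x y : ctx (lang_sort L)) (K : classical_sets.set (linfty R))
    (phi : formula iota (ctx_cat x y) K)
    (q : phi_type phi N) (hq : finitely_satisfiable h q)
    (eps delta : R) (heps : 0 < eps) (hdelta : 0 <= delta)
    (hphi : stable_in phi eps M)
    (psi : pformula iota M y)
    (hpsi : forall b : tuples M y,
       `|q (tuples_map h b) - peval psi b| <= delta) :
  forall b : tuples N y, `|q b - peval_ext h psi b| <= delta + eps.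
Proof.
move=> b; rewrite leNgt; apply/negP => gap; apply: hphi.
(* A quarter of the excess, since four approximation errors add up. *)
have [eta eta0 eta4] : exists2 eta : R, 0 < eta &
    eta * 4 = `|q b - peval_ext h psi b| - (delta + eps).
  exists ((`|q b - peval_ext h psi b| - (delta + eps)) / 4).
    by rewrite divr_gt0// subr_gt0.
  by rewrite mulfVK.
(* [P] relates an earlier pair [s] to a later pair [t]; [Q] constrains each pair on its own. *)
pose P (s t : tuples M x * tuples M y) :=
  `|feval phi (tuples_cat s.1 t.2) -
    feval phi (tuples_cat (tuples_map h s.1) b)| < eta /\
  `|feval phi (tuples_cat t.1 s.2) - q (tuples_map h s.2)| < eta.
pose Q (t : tuples M x * tuples M y) :=
  `|feval phi (tuples_cat (tuples_map h t.1) b) - q b| < eta /\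
  `|peval psi t.2 - peval_ext h psi b| < eta.
have [n s|t [tQ tP]] := @dependent_choice_prefix _ P Q.
  (* [None] stands for [b] itself, [Some i] for the image of the earlier second component. *)
  have [a qa] := finitely_satisfiable_fin
    (oapp (fun i => tuples_map h (s i).2) b) hq eta0.
  (* [None] stands for [psi], [Some i] for phi with the earlier first component as parameters. *)
  have [c pc] := elem_ext_approx h (oapp (fun i =>
    PFormula (swap_formula phi) (s i).1) psi) b eta0.
  exists (a, c); split; first by split; [exact: (qa None)|exact: (pc None)].
  move=> i; split; last by rewrite -(feval_tuples_cat_map h); exact: (qa (Some i)).
  by have := pc (Some i); rewrite /peval /peval_ext/= !feval_swap_formula.
exists (fun i => (t i).1), (fun i => (t i).2) => i j /tP[uw vq].
have [wq pp] := tQ i.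
exact: dist_chain_ge eta4 wq uw vq (hpsi _) pp.
Qed.
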